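(* There is an absolute constant $C>0$ such that the following holds. Let $K\ge1$, let $\mathbf{\Phi}\in\mathbb{R}^{m\times n}$ satisfy the RIP of order $2K$ with isometry constant $\delta_{2K}\in(0,1)$, let $\mathbf{x}\in\mathbb{R}^n$ with $|\mathrm{supp}(\mathbf{x})|=K$, let $\mathbf{v}\in\mathbb{R}^m$, and let $\mathbf{y}=\mathbf{\Phi}\mathbf{x}+\mathbf{v}$. Let $\kappa := \max_{i,j\in\mathrm{supp}(\mathbf{x})} |x_i|/|x_j|$. If $\mathrm{SNR} \ge \kappa^2\delta_{2K}^{-3/2}$, then the support $\mathcal{T}^K$ output by OMP after $K$ iterations satisfies $$\rho_{\mathrm{error}} := \frac{|\mathcal{T}^K\setminus\mathrm{supp}(\mathbf{x})|}{|\mathrm{supp}(\mathbf{x})|} \le C\,\kappa^2\,\delta_{2K}^{1/2}.$$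
   Context: $\phi_i$ is the $i$-th column of $\mathbf{\Phi}$. RIP: for an integer $s\ge1$, the isometry constant $\delta_s$ of $\mathbf{\Phi}$ is the smallest $c\in[0,1)$ such that $(1-c)\|\mathbf{z}\|_2^2 \le \|\mathbf{\Phi}\mathbf{z}\|_2^2 \le (1+c)\|\mathbf{z}\|_2^2$ for all $s$-sparse $\mathbf{z}\in\mathbb{R}^n$. $\mathrm{SNR} := \|\mathbf{\Phi}\mathbf{x}\|_2^2/\|\mathbf{v}\|_2^2$ (taken as $+\infty$ if $\mathbf{v}=\mathbf{0}$). OMP with input $\mathbf{\Phi},\mathbf{y},K$: set $\mathcal{T}^0=\emptyset$, $\mathbf{r}^0=\mathbf{y}$; for $k=1,\dots,K$: choose $t^k \in \arg\max_{i\notin\mathcal{T}^{k-1}} |\langle\phi_i,\mathbf{r}^{k-1}\rangle|$ (ties broken arbitrarily), set $\mathcal{T}^k=\mathcal{T}^{k-1}\cup\{t^k\}$, $\mathbf{x}^k = \arg\min_{\mathrm{supp}(\mathbf{u})\subseteq\mathcal{T}^k}\|\mathbf{y}-\mathbf{\Phi}\mathbf{u}\|_2$, $\mathbf{r}^k=\mathbf{y}-\mathbf{\Phi}\mathbf{x}^k$. Output $\mathcal{T}^K$, $\mathbf{x}^K$. *)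

(* Defs.v *)
From HB Require Import structures.
From mathcomp Require Import all_boot all_order all_algebra.
Set Implicit Arguments. Unset Strict Implicit. Unset Printing Implicit Defensive.
Import Order.TTheory GRing.Theory Num.Theory.
Local Open Scope ring_scope.

Section OMPDefs.
Variable R : rcfType.

Definition supp (n : nat) (z : 'cV[R]_n) : {set 'I_n} := [set i | z i 0 != 0].

Definition norm2sq (n : nat) (z : 'cV[R]_n) : R := \sum_(i < n) (z i 0) ^+ 2.

Definition colip (m n : nat) (Phi : 'M[R]_(m, n)) (i : 'I_n) (r : 'cV[R]_m) : R :=
  \sum_(j < m) Phi j i * r j 0.

Definition rip_ineq (m n : nat) (Phi : 'M[R]_(m, n)) (s : nat) (c : R) : Prop :=
  forall z : 'cV[R]_n, (#|supp z| <= s)%N ->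
    (1 - c) * norm2sq z <= norm2sq (Phi *m z) /\
    norm2sq (Phi *m z) <= (1 + c) * norm2sq z.

Definition is_isometry_const (m n : nat) (Phi : 'M[R]_(m, n)) (s : nat) (d : R) : Prop :=
  [/\ 0 <= d, d < 1, rip_ineq Phi s d &
      forall c, 0 <= c -> c < 1 -> rip_ineq Phi s c -> d <= c].

Definition is_ls_sol (m n : nat) (Phi : 'M[R]_(m, n)) (y : 'cV[R]_m)
    (T : {set 'I_n}) (u : 'cV[R]_n) : Prop :=
  supp u \subset T /\
  forall w : 'cV[R]_n, supp w \subset T ->
    norm2sq (y - Phi *m u) <= norm2sq (y - Phi *m w).

(* omp_reach Phi y k T r : some admissible run of OMP (ties broken arbitrarily,
   any least-squares minimiser) has T^k = T and r^k = r. *)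
Inductive omp_reach (m n : nat) (Phi : 'M[R]_(m, n)) (y : 'cV[R]_m) :
    nat -> {set 'I_n} -> 'cV[R]_m -> Prop :=
| omp_init : omp_reach Phi y 0 set0 y
| omp_step k T r (t : 'I_n) (u : 'cV[R]_n) :
    omp_reach Phi y k T r ->
    t \notin T ->
    (forall i : 'I_n, i \notin T -> `|colip Phi i r| <= `|colip Phi t r|) ->
    is_ls_sol Phi y (t |: T) u ->
    omp_reach Phi y k.+1 (t |: T) (y - Phi *m u).

Definition kappa (n : nat) (x : 'cV[R]_n) : R :=
  \big[Num.max/0]_(i in supp x) \big[Num.max/0]_(j in supp x) (`|x i 0| / `|x j 0|).

(* SNR >= b, with SNR = +infinity when v = 0 *)
Definition snr_ge (m n : nat) (Phi : 'M[R]_(m, n)) (x : 'cV[R]_n) (v : 'cV[R]_m) (b : R) : Prop :=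
  v = 0 \/ b <= norm2sq (Phi *m x) / norm2sq v.

End OMPDefs.

(* Main.v *)
Require Import Defs.
From HB Require Import structures.
From mathcomp Require Import all_boot all_order all_algebra.
From mathcomp Require Import ring lra.
Set Implicit Arguments. Unset Strict Implicit. Unset Printing Implicit Defensive.
Import Order.TTheory GRing.Theory Num.Theory.
Local Open Scope ring_scope.

(** Write [q = sqrt d], [S = supp x], [a = min_S |x_i|].  Before each step the
    residual is [Phi h + v] with [h = x - u] agreeing with [x] on [S :\: T], and
    RIP makes the vector of errors [<phi_i, r> - x_i], [i] in [S :\: T], of
    squared length at most [25 q^3 K a^2].  So at most [N <= 25 q K] of these
    errors exceed [q a], and since step [k + 1] finds at most [k] indices already
    used, one of the [N + k + 1] largest entries of [x] is both unused and
    accurately seen.  The greedy choice therefore lowers the energy by at least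
    about [(1 - 2q)] times the square of the [(N + k + 1)]-st largest entry,
    whether or not the selected index is correct.  Summed over all steps this
    removes all but [O(q kappa^2 K a^2)] of the initial energy, whereas each
    missed index of [S] keeps about [a^2] in the final residual. *)

(** * Inner products, supports and restrictions of column vectors *)

Section Euclidean.
Variable R : rcfType.
Implicit Types m n : nat.

Definition dot {n} (a b : 'cV[R]_n) : R := \sum_i a i 0 * b i 0.

Lemma dotC n (a b : 'cV[R]_n) : dot a b = dot b a.
Proof. by apply: eq_bigr => i _; rewrite mulrC. Qed.

Lemma dotDl n (a b c : 'cV[R]_n) : dot (a + b) c = dot a c + dot b c.
Proof. by rewrite -big_split; apply: eq_bigr => i _; rewrite !mxE mulrDl. Qed.

Lemma dotZl n k (a b : 'cV[R]_n) : dot (k *: a) b = k * dot a b.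
Proof. by rewrite mulr_sumr; apply: eq_bigr => i _; rewrite !mxE mulrA. Qed.

Lemma norm2sqE n (a : 'cV[R]_n) : norm2sq a = dot a a.
Proof. by apply: eq_bigr => i _; rewrite expr2. Qed.

Lemma norm2sq_ge0 n (a : 'cV[R]_n) : 0 <= norm2sq a.
Proof. by apply: sumr_ge0 => i _; rewrite sqr_ge0. Qed.

Lemma norm2sqDZ n k (a b : 'cV[R]_n) :
  norm2sq (a + k *: b) = norm2sq a + 2 * k * dot a b + k ^+ 2 * norm2sq b.
Proof.
rewrite !norm2sqE dotDl dotZl dotC (dotC b) !(dotDl, dotZl) (dotC b a); ring.
Qed.

Lemma norm2sqZ n k (a : 'cV[R]_n) : norm2sq (k *: a) = k ^+ 2 * norm2sq a.
Proof. by rewrite !norm2sqE dotZl dotC dotZl expr2 mulrA. Qed.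

(** Expand the square of [b - s a] and divide by [s]; the free weight [s] lets later estimates
    choose which vector carries the small factor. *)
Lemma dot_young n s (a b : 'cV[R]_n) : 0 < s ->
  2 * dot a b <= s * norm2sq a + s^-1 * norm2sq b.
Proof.
move=> s0; have := norm2sq_ge0 (b + (- s) *: a).
rewrite norm2sqDZ dotC => H.
have si : s * s^-1 = 1 by rewrite divff ?gt_eqF.
have si0 : 0 <= s^-1 by rewrite invr_ge0 ltW.
have := mulr_ge0 si0 H; set t := s^-1 in si si0 *.
have -> : t * (norm2sq b + 2 * - s * dot a b + (- s) ^+ 2 * norm2sq a) =
  t * norm2sq b - (s * t) * (2 * dot a b) + (s * t) * (s * norm2sq a) by ring.
rewrite si; lra.
Qed.

Lemma norm2sqD_le n s (a b : 'cV[R]_n) : 0 < s ->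
  norm2sq (a + b) <= (1 + s) * norm2sq a + (1 + s^-1) * norm2sq b.
Proof.
move=> s0; rewrite -{1}(scale1r b) norm2sqDZ; have := dot_young a b s0; lra.
Qed.

Lemma suppD n (a b : 'cV[R]_n) : supp (a + b) \subset supp a :|: supp b.
Proof.
apply/subsetP => i; rewrite !inE mxE; apply: contraTT.
by rewrite negb_or !negbK => /andP[/eqP-> /eqP->]; rewrite addr0.
Qed.

Lemma suppZ n k (a : 'cV[R]_n) : supp (k *: a) \subset supp a.
Proof.
by apply/subsetP => i; rewrite !inE mxE; apply: contraNN => /eqP->; rewrite mulr0.
Qed.

Lemma supp_delta n (i : 'I_n) : supp (delta_mx i 0 : 'cV[R]_n) = [set i].
Proof.
by apply/setP => j; rewrite !inE !mxE eqxx andbT; case: (j == i); rewrite ?oner_eq0 ?eqxx.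
Qed.

Lemma norm2sq_delta n (i : 'I_n) : norm2sq (delta_mx i 0 : 'cV[R]_n) = 1.
Proof.
rewrite /norm2sq (bigD1 i) //= mxE !eqxx /= expr1n big1 ?addr0 // => j /negPf ji.
by rewrite mxE ji expr0n.
Qed.

Definition restrict n (A : {set 'I_n}) (z : 'cV[R]_n) : 'cV[R]_n :=
  \col_i (if i \in A then z i 0 else 0).

Lemma supp_restrict n (A : {set 'I_n}) z : supp (restrict A z) \subset A.
Proof. by apply/subsetP => i; rewrite inE mxE; case: ifP; rewrite ?eqxx. Qed.

Lemma norm2sq_restrict n (A : {set 'I_n}) z :
  norm2sq (restrict A z) = \sum_(i in A) z i 0 ^+ 2.
Proof.
by rewrite big_mkcond; apply: eq_bigr => i _; rewrite mxE; case: ifP; rewrite ?expr0n.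
Qed.

Lemma norm2sq_restrict_le n (A : {set 'I_n}) z : norm2sq (restrict A z) <= norm2sq z.
Proof.
apply: ler_sum => i _; rewrite mxE; case: ifP => // _.
by rewrite expr0n sqr_ge0.
Qed.

Lemma dot_mulmx m n (Phi : 'M[R]_(m, n)) g r :
  dot (Phi *m g) r = \sum_i g i 0 * colip Phi i r.
Proof.
rewrite /dot; under eq_bigr => j _ do rewrite mxE mulr_suml.
rewrite exchange_big; apply: eq_bigr => i _ /=; rewrite mulr_sumr.
by apply: eq_bigr => j _; ring.
Qed.

Lemma colip_delta m n (Phi : 'M[R]_(m, n)) i r :
  colip Phi i r = dot (Phi *m delta_mx i 0) r.
Proof.
rewrite dot_mulmx (bigD1 i) //= mxE !eqxx /= mul1r big1 ?addr0 // => j /negPf ji.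
by rewrite mxE ji mul0r.
Qed.

End Euclidean.

(** * Residuals of least-squares solutions along an OMP run *)

Section LeastSquares.
Variables (R : rcfType) (m n : nat) (Phi : 'M[R]_(m, n)).
Implicit Types (y r : 'cV[R]_m) (u x z : 'cV[R]_n) (T S : {set 'I_n}).

(** The new minimiser is compared with the competitor [u + c e_t]. Leaving [c] free allows both an
    optimised step and the null step. *)
Lemma ls_step_le y T u t u' c :
  is_ls_sol Phi y T u -> is_ls_sol Phi y (t |: T) u' ->
  norm2sq (y - Phi *m u') <=
    norm2sq (y - Phi *m u) - 2 * c * colip Phi t (y - Phi *m u)
    + c ^+ 2 * norm2sq (Phi *m delta_mx t 0).
Proof.
move=> [sT _] [_ /(_ (u + c *: delta_mx t 0)) H].
have /H : supp (u + c *: delta_mx t 0) \subset t |: T.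
  apply: subset_trans (suppD _ _) _; rewrite subUset (subset_trans sT) ?subsetUr //=.
  by apply: subset_trans (suppZ _ _) _; rewrite supp_delta subsetUl.
have -> : y - Phi *m (u + c *: delta_mx t 0) =
   (y - Phi *m u) + (- c) *: (Phi *m delta_mx t 0).
  by rewrite mulmxDr -scalemxAr scaleNr opprD addrA.
by move=> /le_trans; apply; rewrite norm2sqDZ colip_delta dotC; lra.
Qed.

Lemma omp_reach_ls y k T r : omp_reach Phi y k T r ->
  #|T| = k /\ exists2 u, is_ls_sol Phi y T u & r = y - Phi *m u.
Proof.
elim=> [|k' T' r' t u _ [cT _] tT _ lsu].
  rewrite cards0; split=> //; exists 0; last by rewrite mulmx0 subr0.
  have s0 : supp (0 : 'cV[R]_n) = set0 by apply/setP => i; rewrite !inE mxE eqxx.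
  split=> [|w]; first by rewrite s0.
  (* For [T = set0] the zero vector is the only candidate, so the initial residual is also a
     least-squares residual. *)
  rewrite subset0 => /eqP w0; suff -> : w = 0 by [].
  apply/colP => i; apply/eqP; rewrite mxE.
  by have := in_set0 i; rewrite -w0 inE => /negbFE.
by rewrite cardsU1 tT cT; split=> //; exists u.
Qed.

End LeastSquares.

(** * Consequences of the RIP for inner products, proxies and least-squares errors *)

Section RIP.
Variables (R : rcfType) (m n : nat) (Phi : 'M[R]_(m, n)) (s : nat) (d : R).
Hypotheses (ripP : rip_ineq Phi s d) (d_gt0 : 0 < d) (d_le : d <= 4^-1).

Lemma rip_ge z : (#|supp z| <= s)%N -> (1 - d) * norm2sq z <= norm2sq (Phi *m z).
Proof. by case/ripP. Qed.

Lemma rip_le z : (#|supp z| <= s)%N -> norm2sq (Phi *m z) <= (1 + d) * norm2sq z.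
Proof. by case/ripP. Qed.

(** Polarization: the upper RIP bound at [a + b] minus the lower one at [a - b]. *)
Lemma rip_dot (A : {set 'I_n}) a b : (#|A| <= s)%N ->
  supp a \subset A -> supp b \subset A ->
  dot (Phi *m a) (Phi *m b) - dot a b <= d / 2 * (norm2sq a + norm2sq b).
Proof.
move=> As aA bA.
have H k : (#|supp (a + k *: b)| <= s)%N.
  apply: leq_trans As; apply: subset_leq_card; apply: subset_trans (suppD _ _) _.
  by rewrite subUset aA (subset_trans (suppZ _ _)).
have := rip_le (H 1); have := rip_ge (H (-1)).
by rewrite !mulmxDr -!scalemxAr !norm2sqDZ; nra.
Qed.

(** [rip_dot] for [g] and [2 d h], divided by [2 d]: [h] gets the factor [d ^+ 2], and the term in
    [g] is small enough to be absorbed later. *)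
Lemma rip_dot_young (A : {set 'I_n}) g h : (#|A| <= s)%N ->
  supp g \subset A -> supp h \subset A ->
  dot (Phi *m g) (Phi *m h) - dot g h <= norm2sq g / 4 + d ^+ 2 * norm2sq h.
Proof.
move=> As gA hA.
have := rip_dot As gA (subset_trans (suppZ (2 * d) _) hA).
rewrite -!scalemxAr norm2sqZ 2![dot _ (_ *: _)]dotC !dotZl (dotC _ g) (dotC _ (Phi *m g)).
have -> : 2 * d * dot (Phi *m g) (Phi *m h) - 2 * d * dot g h =
  (2 * d) * (dot (Phi *m g) (Phi *m h) - dot g h) by ring.
have -> : d / 2 * (norm2sq g + (2 * d) ^+ 2 * norm2sq h) =
  (2 * d) * (norm2sq g / 4 + d ^+ 2 * norm2sq h) by field.
by rewrite ler_pM2l // mulr_gt0.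
Qed.

(* Test the residual [Phi h + v] against the vector of proxy errors itself. *)
Lemma proxy_error_le (A G : {set 'I_n}) h v : (#|A| <= s)%N ->
  supp h \subset A -> G \subset A ->
  \sum_(i in G) (colip Phi i (Phi *m h + v) - h i 0) ^+ 2 <=
    2 * d ^+ 2 * norm2sq h + 4 * norm2sq v.
Proof.
move=> As hA GA; set r := Phi *m h + v.
pose g := restrict G (\col_i (colip Phi i r - h i 0)).
have gA : supp g \subset A := subset_trans (supp_restrict _ _) GA.
have <- : norm2sq g = \sum_(i in G) (colip Phi i r - h i 0) ^+ 2.
  by rewrite norm2sq_restrict; apply: eq_bigr => i _; rewrite mxE.
have gE : norm2sq g = dot (Phi *m g) (Phi *m h) - dot g h + dot (Phi *m g) v.
  have -> : norm2sq g = dot (Phi *m g) r - dot g h.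
    rewrite dot_mulmx -sumrB; apply: eq_bigr => i _.
    by rewrite !mxE; case: ifP => _; ring.
  by rewrite /r dotC dotDl ![dot _ (Phi *m g)]dotC; ring.
have gs : (#|supp g| <= s)%N := leq_trans (subset_leq_card gA) As.
have := rip_dot_young As gA hA; have := rip_le gs.
(* Weight 1/4 leaves at most 1/4 + 5/32 < 1/2 of [norm2sq g] on the right, which is absorbed on the
   left. *)
have := @dot_young _ _ (4^-1) (Phi *m g) v; rewrite invrK => Y; have {}Y := Y ltac:(lra).
have g0 := norm2sq_ge0 g; have : d * norm2sq g <= 4^-1 * norm2sq g by rewrite ler_wpM2r.
by move: (norm2sq g) g0 gE Y => N g0 gE Y; lra.
Qed.

(** The competitor [restrict T x] has residual [Phi x' + v], with [x'] the part of [x] off [T]. The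
    lower RIP bound then turns the residual of [u] into an estimate of [x - u]. *)
Lemma ls_error_le x v T u : (#|supp x :|: T| <= s)%N ->
  is_ls_sol Phi (Phi *m x + v) T u ->
  norm2sq (x - u) <= 7 * norm2sq x + 8 * norm2sq v.
Proof.
move=> As [uT umin].
have /umin : supp (restrict T x) \subset T := supp_restrict _ _.
have -> : Phi *m x + v - Phi *m u = Phi *m (x - u) + v by rewrite mulmxBr addrAC.
have -> : Phi *m x + v - Phi *m restrict T x = Phi *m restrict (~: T) x + v.
  rewrite addrAC -mulmxBr; congr (_ *m _ + _); apply/colP => i; rewrite !mxE inE.
  by case: ifP => _ /=; rewrite ?subrr ?subr0.
set h := x - u => r_le.
have hs : (#|supp h| <= s)%N.
  apply: leq_trans As; apply: subset_leq_card; apply: subset_trans (suppD _ _) _.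
  apply: setUSS => //; apply: subset_trans uT.
  by rewrite -scaleN1r suppZ.
have xs : (#|supp (restrict (~: T) x)| <= s)%N.
  apply: leq_trans As; apply: subset_leq_card; apply: subset_trans (subsetUl _ _).
  by apply/subsetP => i; rewrite !inE mxE; case: ifP; rewrite ?eqxx.
have := rip_ge hs; have := rip_le xs.
have := norm2sq_restrict_le (~: T) x; have := norm2sq_ge0 (restrict (~: T) x).
have := norm2sqD_le (Phi *m restrict (~: T) x) v ltr01.
have := norm2sqD_le (Phi *m h + v) (- v) ltr01.
rewrite addrK -(scaleN1r v) norm2sqZ invr1.
have : d * norm2sq h <= 4^-1 * norm2sq h by rewrite ler_wpM2r ?norm2sq_ge0.
have : d * norm2sq (restrict (~: T) x) <= 4^-1 * norm2sq (restrict (~: T) x).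
  by rewrite ler_wpM2r ?norm2sq_ge0.
by move: r_le; lra.
Qed.
End RIP.

(** * Counting arguments and the energy decrease of greedy selection *)

Section Greedy.
Variables (R : rcfType).

Lemma ler_sqr_norm (a b : R) : `|a| <= `|b| -> a ^+ 2 <= b ^+ 2.
Proof.
move=> ab; rewrite -(real_normK (num_real a)) -[leRHS](real_normK (num_real b)).
by rewrite ler_pXn2r ?nnegrE ?normr_ge0.
Qed.

(** Chebyshev's inequality for the counting measure. *)
Lemma card_large_le (I : finType) (G : {set I}) (e : I -> R) (c E : R) :
  0 < c -> \sum_(i in G) e i ^+ 2 <= c ^+ 2 * E ->
  #|[set i in G | c < `|e i|]|%:R <= E.
Proof.
move=> c0 sumE; rewrite -(ler_pM2l (exprn_gt0 2 c0)); apply: le_trans sumE.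
set B := [set i in G | _].
rewrite (big_setID B) /= [G :&: B](setIidPr _); last first.
  by apply/subsetP => i; rewrite inE => /andP[].
rewrite -[leLHS]addr0 lerD ?sumr_ge0 // => [|i _]; last by rewrite sqr_ge0.
rewrite mulr_natr -sumr_const; apply: ler_sum => i; rewrite inE => /andP[_ lt_c].
by rewrite ler_sqr_norm // gtr0_norm // ltW.
Qed.

(** Pigeonhole: the first [k + 1] entries of [s] cannot all lie in [B], and each weighs at least as
    much as the last of them, at position [k] counted from 0. *)
Lemma exists_large_avoiding (I : finType) (i0 : I) (w : I -> R) (s : seq I)
    (B : {set I}) (k : nat) :
  uniq s -> sorted (fun i j => w j <= w i) s -> (#|B| <= k)%N -> (k < size s)%N ->
  exists i, [/\ i \in s, i \notin B & w (nth i0 s k) <= w i].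
Proof.
move=> us ss Bk ks; pose L := [set i in take k.+1 s].
have cL : #|L| = k.+1.
  by rewrite cardsE (card_uniqP _) ?take_uniq // size_takel.
have /subsetPn[i iL iB] : ~~ (L \subset B).
  by apply/negP => /subset_leq_card; rewrite cL ltnNge Bk.
have it : i \in take k.+1 s by rewrite inE in iL.
exists i; split=> //; first exact: mem_take it.
have := nth_index i0 it; have := it; rewrite -index_mem size_takel // => ltk.
rewrite nth_take // => <-.
apply: (sorted_leq_nth _ _ i0 ss) => //.
- by move=> x1 x2 x3 /= H1 H2; apply: le_trans H2 H1.
- by rewrite inE (leq_ltn_trans _ ks).
Qed.

Lemma sum_drop_ge (I : Type) (i0 : I) (w : I -> R) (s : seq I) (N : nat) (c : R) :
  (forall i, w i <= c) -> 0 <= c ->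
  \sum_(i <- s) w i - N%:R * c <= \sum_(j < size s - N) w (nth i0 s (N + j)).
Proof.
move=> wc c0; rewrite -[s in leLHS](cat_take_drop N) big_cat /=.
have -> : \sum_(j < size s - N) w (nth i0 s (N + j)) = \sum_(i <- drop N s) w i.
  rewrite (big_nth i0) size_drop big_mkord.
  by apply: eq_bigr => j _; rewrite nth_drop.
rewrite addrAC -[leRHS]add0r lerD2r subr_le0.
apply: le_trans (ler_sum _ (fun i _ => wc i)) _.
rewrite big_const_seq count_predT iter_addr_0 mulr_natl ler_wpMn2l //.
by rewrite size_take_min geq_minl.
Qed.

Lemma omp_energy_le (m n : nat) (Phi : 'M[R]_(m, n)) (y : 'cV[R]_m) (c : R)
    (M : nat) (eta : nat -> R) :
  0 < c -> (forall t, norm2sq (Phi *m delta_mx t 0) <= c) ->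
  (forall k T r, omp_reach Phi y k T r -> (k < M)%N ->
     exists2 i, i \notin T & eta k <= colip Phi i r ^+ 2) ->
  forall k T r, omp_reach Phi y k T r ->
    norm2sq r <= norm2sq y - (\sum_(j < minn k M) eta j) / c.
Proof.
move=> c0 colc eta_le k T r; elim=> [|k' T' r' t u reach IH tT tmax lsu].
  by rewrite min0n big_ord0 mul0r subr0.
have [_ [u' lsu' r'E]] := omp_reach_ls reach.
have step b := ls_step_le b lsu' lsu; rewrite -r'E in step.
case: (ltnP k' M) => kM; last first.
  rewrite (minn_idPr (leqW kM)) -(minn_idPr kM).
  (* After the first [M] steps only monotonicity is claimed, via the null step. *)
  apply: le_trans IH; move: (step 0).
  by rewrite !mulr0 !mul0r expr0n /= mul0r subr0 addr0.
rewrite (minn_idPl kM) big_ord_recr /=; rewrite (minn_idPl (ltnW kM)) in IH.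
have [i iT ieta] := eta_le _ _ _ reach kM.
have {ieta} : eta k' <= colip Phi t r' ^+ 2.
  by apply: le_trans ieta _; rewrite ler_sqr_norm ?tmax.
rewrite -(ler_pM2r (_ : 0 < c^-1)) ?invr_gt0 // mulrDl => eta_c.
(* This step length minimises [- 2 b g + b ^+ 2 c] over [b], with value [- g ^+ 2 / c]. *)
have := step (colip Phi t r' / c); move: (colip Phi t r') eta_c => g eta_c.
have : (g / c) ^+ 2 * norm2sq (Phi *m delta_mx t 0) <= (g / c) ^+ 2 * c.
  by rewrite ler_wpM2l ?sqr_ge0.
have -> : (g / c) ^+ 2 * c = g ^+ 2 / c by field; rewrite gt_eqF.
have -> : 2 * (g / c) * g = 2 * (g ^+ 2 / c) by field; rewrite gt_eqF.
lra.
Qed.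

End Greedy.

(** * Error analysis of OMP when [kap ^+ 2 * q] is small *)

Section Error.
Variables (R : rcfType) (m n K N : nat) (Phi : 'M[R]_(m, n)) (d q a kap : R).
Variables (x : 'cV[R]_n) (v : 'cV[R]_m).
Implicit Types (T : {set 'I_n}) (u : 'cV[R]_n) (r : 'cV[R]_m).
Local Notation S := (supp x).
Local Notation y := (Phi *m x + v).
Hypotheses (dq : d = q ^+ 2) (q_gt0 : 0 < q) (kap_ge1 : 1 <= kap).
Hypothesis kapq : kap ^+ 2 * q <= 100^-1.
Hypotheses (ripP : rip_ineq Phi (2 * K) d) (K_gt0 : (0 < K)%N) (cardS : #|S| = K).
Hypotheses (a_gt0 : 0 < a) (x_ge : forall i, i \in S -> a <= `|x i 0|).
Hypothesis x_le : forall i, `|x i 0| <= kap * a.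
Hypothesis v_le : kap ^+ 2 * norm2sq v <= q ^+ 3 * norm2sq (Phi *m x).
(** With [N_le], this makes [N] the integer part of [25 q K], which is below [K] because
    [q <= 1/100]. *)
Hypothesis N_max : forall j : nat, (j <= K)%N -> j%:R <= 25 * q * K%:R -> (j <= N)%N.
Hypothesis N_le : N%:R <= 25 * q * K%:R.

Let kap2_ge1 : 1 <= kap ^+ 2.
Proof. by rewrite exprn_ege1. Qed.

Let q_le : q <= 100^-1.
Proof. by apply: le_trans kapq; rewrite ler_peMl // ltW. Qed.

Let d_gt0 : 0 < d. Proof. by rewrite dq exprn_gt0. Qed.

Let d_le : d <= 4^-1. Proof. by rewrite dq; move: q_gt0 q_le; nra. Qed.

Let suppx2K : (#|S| <= 2 * K)%N.
Proof. by rewrite cardS leq_pmull. Qed.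

Lemma norm2sq_flat_le : norm2sq x <= K%:R * (kap * a) ^+ 2.
Proof.
rewrite /norm2sq (bigID (mem S)) /= addrC big1 ?add0r => [|i]; last first.
  by rewrite inE negbK => /eqP->; rewrite expr0n.
rewrite -cardS mulr_natl -sumr_const; apply: ler_sum => i _.
by rewrite ler_sqr_norm // [leRHS]ger0_norm // (le_trans _ (x_le i)).
Qed.

(** The [kap ^+ 2] in the SNR hypothesis cancels the one in [norm2sq_flat_le], so the bound is free
    of [kap]. *)
Lemma noise_le : norm2sq v <= 5 / 4 * (q ^+ 3 * (K%:R * a ^+ 2)).
Proof.
rewrite -(ler_pM2l (lt_le_trans ltr01 kap2_ge1)); apply: le_trans v_le _.
have -> : kap ^+ 2 * (5 / 4 * (q ^+ 3 * (K%:R * a ^+ 2))) =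
  q ^+ 3 * (5 / 4 * (K%:R * (kap * a) ^+ 2)) by ring.
rewrite ler_pM2l ?exprn_gt0 //; apply: le_trans (rip_le ripP suppx2K) _.
by apply: ler_pM norm2sq_flat_le; rewrite ?norm2sq_ge0 //; move: d_gt0 d_le; lra.
Qed.

(** On [S :\: T] the vector [u] vanishes, so [x - u] agrees with [x]. As [d ^+ 2 = q ^+ 4], one
    spare factor [q] absorbs [kap ^+ 2] through [kapq]. The right side is factored for
    [card_large_le] with threshold [q a]. *)
Lemma proxy_error_state T u : (#|T| <= K)%N -> is_ls_sol Phi y T u ->
  \sum_(i in S :\: T) (colip Phi i (y - Phi *m u) - x i 0) ^+ 2 <=
    (q * a) ^+ 2 * (25 * q * K%:R).
Proof.
move=> TK lsu.
have As : (#|S :|: T| <= 2 * K)%N.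
  by rewrite (leq_trans (leq_card_setU _ _)) // mul2n -addnn leq_add ?cardS.
have hA : supp (x - u) \subset S :|: T.
  apply: subset_trans (suppD _ _) _; apply: setUSS => //.
  by rewrite -scaleN1r (subset_trans (suppZ _ _)) //; case: lsu.
have GA : S :\: T \subset S :|: T by rewrite subDset setUCA subsetUl.
have -> : \sum_(i in S :\: T) (colip Phi i (y - Phi *m u) - x i 0) ^+ 2 =
    \sum_(i in S :\: T) (colip Phi i (Phi *m (x - u) + v) - (x - u) i 0) ^+ 2.
  apply: eq_bigr => i; rewrite in_setD => /andP[iT _].
  rewrite mulmxBr [Phi *m x - _ + v]addrAC !mxE; suff -> : u i 0 = 0 by rewrite subr0.
  case: lsu => /subsetP/(_ i)/contra; rewrite inE negbK => H _.
  exact/eqP/H.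
apply: le_trans (proxy_error_le ripP d_gt0 d_le v As hA GA) _.
have h_le := ls_error_le ripP d_le As lsu.
have X := norm2sq_flat_le; have V := noise_le.
have V0 := norm2sq_ge0 v.
have {h_le X} : d ^+ 2 * norm2sq (x - u) <=
    d ^+ 2 * (7 * (K%:R * (kap * a) ^+ 2) + 8 * norm2sq v).
  by rewrite ler_wpM2l ?exprn_ge0 ?(ltW d_gt0) //; lra.
have -> : d ^+ 2 * (7 * (K%:R * (kap * a) ^+ 2) + 8 * norm2sq v) =
  7 * ((kap ^+ 2 * q) * (q ^+ 3 * (K%:R * a ^+ 2))) + 8 * (d ^+ 2 * norm2sq v).
  by rewrite dq; ring.
have -> : (q * a) ^+ 2 * (25 * q * K%:R) = 25 * (q ^+ 3 * (K%:R * a ^+ 2)) by ring.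
have Q0 : 0 <= q ^+ 3 * (K%:R * a ^+ 2) by rewrite !mulr_ge0 ?exprn_ge0 // ltW.
have := ler_wpM2r Q0 kapq.
have : d ^+ 2 * norm2sq v <= 4^-1 * norm2sq v.
  by rewrite ler_wpM2r //; move: d_gt0 d_le; nra.
lra.
Qed.

Let w i := x i 0 ^+ 2.
Let xs := sort (fun i j => w j <= w i) (enum S).

Let xs_perm : perm_eq xs (enum S). Proof. by rewrite perm_sort. Qed.

Let xs_size : size xs = K. Proof. by rewrite (perm_size xs_perm) -cardE. Qed.

Lemma omp_proxy_large (i0 : 'I_n) k T r :
  omp_reach Phi y k T r -> (k < K - N)%N ->
  exists2 i, i \notin T & (1 - q) ^+ 2 * w (nth i0 xs (N + k)) <= colip Phi i r ^+ 2.
Proof.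
move=> reach kKN; have [cT [u lsu rE]] := omp_reach_ls reach.
have kN : (N + k < K)%N by rewrite -ltn_subRL.
have TK : (#|T| <= K)%N by rewrite cT ltnW // (leq_ltn_trans (leq_addl N k)).
pose e i := colip Phi i r - x i 0.
pose B := [set i in S :\: T | q * a < `|e i|].
have BN : (#|B| <= N)%N.
  apply: N_max.
    rewrite -cardS subset_leq_card //.
    by apply/subsetP => i; rewrite !inE => /andP[/andP[]].
  by apply: card_large_le; rewrite ?mulr_gt0 // /e rE; apply: proxy_error_state.
have BT : (#|B :|: T| <= N + k)%N.
  by rewrite (leq_trans (leq_card_setU _ _)) // leq_add ?cT.
have xs_sorted : sorted (fun i j => w j <= w i) xs.
  by apply: sort_sorted => i j; apply: le_total.
have xs_uniq : uniq xs by rewrite sort_uniq enum_uniq.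
have [|i [ix]] := exists_large_avoiding i0 xs_uniq xs_sorted BT; first by rewrite xs_size.
rewrite inE negb_or => /andP[iB iT] wi; exists i => //.
have iS : i \in S by move: ix; rewrite (perm_mem xs_perm) mem_enum.
have ei : `|e i| <= q * a by move: iB; rewrite inE in_setD iT iS /= -leNgt.
have := x_ge iS => ai.
apply: le_trans (_ : ((1 - q) * `|x i 0|) ^+ 2 <= _).
  by rewrite exprMn real_normK ?num_real // ler_wpM2l // sqr_ge0.
rewrite ler_sqr_norm // normrM normr_id ger0_norm; last by have := q_le; lra.
have : `|x i 0| <= `|colip Phi i r| + `|e i|.
  have -> : x i 0 = colip Phi i r - e i by rewrite /e; ring.
  by rewrite ler_normB.
have : q * a <= q * `|x i 0| by rewrite ler_wpM2l // ltW.
lra.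
Qed.

(** The initial energy is at most [(1 + 7 q) norm2sq x] and at least
    [(1 - 2 q) (norm2sq x - 25 q W)] is removed; 7 + 2 + 25 gives 34. *)
Lemma omp_final_residual T r : omp_reach Phi y K T r ->
  norm2sq r <= 34 * q * (K%:R * (kap * a) ^+ 2).
Proof.
move=> reach.
have [i0 _] : exists i, i \in S by apply/set0Pn; rewrite -card_gt0 cardS.
have d1 : 0 < 1 + d by rewrite addr_gt0.
have colP t : norm2sq (Phi *m delta_mx t 0) <= 1 + d.
  have := rip_le ripP (_ : (#|supp (delta_mx t 0%R : 'cV[R]_n)| <= 2 * K)%N).
  by rewrite supp_delta cards1 norm2sq_delta mulr1; apply; rewrite muln_gt0.
have := omp_energy_le d1 colP (@omp_proxy_large i0) reach.
rewrite (minn_idPr (leq_subr _ _)) -mulr_sumr.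
have wle i : w i <= (kap * a) ^+ 2.
  by rewrite ler_sqr_norm // [leRHS]ger0_norm // (le_trans _ (x_le i)).
have W0 : 0 <= (kap * a) ^+ 2 by rewrite sqr_ge0.
have := sum_drop_ge i0 xs N wle W0; rewrite xs_size.
have -> : \sum_(i <- xs) w i = norm2sq x.
  rewrite (perm_big _ xs_perm) big_enum /= /norm2sq [RHS](bigID (mem S)) /=.
  rewrite [X in _ = _ + X]big1 ?addr0 // => i.
  by rewrite inE negbK => /eqP->; rewrite expr0n.
set Sg := \sum_(j < _) _ => Sg_ge r_le.
have X := norm2sq_flat_le; set W := K%:R * (kap * a) ^+ 2 in X *.
have NW : N%:R * (kap * a) ^+ 2 <= 25 * q * W.
  by rewrite /W mulrA ler_wpM2r.
have Sg0 : 0 <= Sg by apply: sumr_ge0 => j _; apply: sqr_ge0.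
have coef : (1 - 2 * q) * Sg <= (1 - q) ^+ 2 * Sg / (1 + d).
  rewrite mulrAC ler_wpM2r // ler_pdivlMr // dq; have := q_gt0; have := q_le; nra.
have q2 : 0 <= 1 - 2 * q by have := q_le; lra.
have Sg_ge' : (1 - 2 * q) * (norm2sq x - 25 * q * W) <= (1 - 2 * q) * Sg.
  by rewrite ler_wpM2l //; lra.
(* With weight [q] the noise costs a factor [1 + q^-1], still harmless against its size [q ^+ 3]. *)
have y_le := norm2sqD_le (Phi *m x) v q_gt0.
have P_le := rip_le ripP suppx2K.
have X0 := norm2sq_ge0 x; have P0 := norm2sq_ge0 (Phi *m x); have V0 := norm2sq_ge0 v.
have v_le' : norm2sq v <= q ^+ 3 * norm2sq (Phi *m x).
  by apply: le_trans v_le; rewrite ler_peMl.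
have {}y_le : norm2sq y <= (1 + 3 * q) * norm2sq (Phi *m x).
  apply: le_trans y_le _.
  have : (1 + q^-1) * norm2sq v <= (1 + q^-1) * (q ^+ 3 * norm2sq (Phi *m x)).
    by rewrite ler_wpM2l // addr_ge0 // invr_ge0 ltW.
  have -> : (1 + q^-1) * (q ^+ 3 * norm2sq (Phi *m x)) = (q ^+ 3 + q ^+ 2) * norm2sq (Phi *m x).
    by field; rewrite gt_eqF.
  have : (q ^+ 3 + q ^+ 2) * norm2sq (Phi *m x) <= 2 * q * norm2sq (Phi *m x).
    by rewrite ler_wpM2r //; have := q_gt0; have := q_le; nra.
  lra.
have {y_le} : norm2sq y <= (1 + 7 * q) * norm2sq x.
  apply: le_trans y_le _.
  have : (1 + 3 * q) * norm2sq (Phi *m x) <= (1 + 3 * q) * ((1 + d) * norm2sq x).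
    by rewrite ler_wpM2l //; have := q_gt0; lra.
  move/le_trans; apply; rewrite mulrA ler_wpM2r // dq; have := q_gt0; have := q_le; nra.
have qX : q * norm2sq x <= q * W by rewrite ler_wpM2l // ltW.
(* Gives the sign of the second-order term [50 q ^+ 2 W], which is dropped. *)
have W1 := mulr_ge0 (mulr_ge0 (ltW q_gt0) (le_trans X0 X)) (ltW q_gt0).
lra.
Qed.

(** Each missed index leaves at least [a ^+ 2] in [norm2sq (x - u)], which the lower RIP bound
    controls by residual and noise: 4/3 times (68 + 5/2) is below 100. *)
Lemma omp_missed_le T r : omp_reach Phi y K T r ->
  #|S :\: T|%:R <= 100 * (kap ^+ 2 * q * K%:R).
Proof.
move=> reach; have r_le := omp_final_residual reach.
have [cT [u [uT _] rE]] := omp_reach_ls reach.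
set h := x - u.
have rE' : r = Phi *m h + v by rewrite rE mulmxBr addrAC.
have hs : (#|supp h| <= 2 * K)%N.
  apply: leq_trans (subset_leq_card (suppD _ _)) _.
  apply: leq_trans (leq_card_setU _ _) _; rewrite mul2n -addnn leq_add ?cardS // -cT.
  by rewrite subset_leq_card // -scaleN1r (subset_trans (suppZ _ _)).
have lo : #|S :\: T|%:R * a ^+ 2 <= norm2sq h.
  apply: le_trans (norm2sq_restrict_le (S :\: T) h).
  rewrite norm2sq_restrict mulr_natl -sumr_const; apply: ler_sum => i.
  rewrite in_setD => /andP[iT iS].
  have -> : h i 0 = x i 0.
    rewrite !mxE; suff -> : u i 0 = 0 by rewrite subr0.
    move/subsetP: uT => /(_ i)/contra; rewrite inE negbK => H.
    exact/eqP/H.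
  by rewrite ler_sqr_norm // gtr0_norm // x_ge.
have := rip_ge ripP hs; have := norm2sqD_le (Phi *m h + v) (- v) ltr01.
rewrite addrK -(scaleN1r v) norm2sqZ invr1 -rE' => up low.
have V := noise_le.
have dh : d * norm2sq h <= 4^-1 * norm2sq h by rewrite ler_wpM2r ?norm2sq_ge0.
have Q : q ^+ 3 * (K%:R * a ^+ 2) <= q * (K%:R * (kap * a) ^+ 2).
  have -> : q * (K%:R * (kap * a) ^+ 2) = (q * kap ^+ 2) * (K%:R * a ^+ 2) by ring.
  rewrite ler_wpM2r ?mulr_ge0 ?(ltW a_gt0) // exprS ler_wpM2l ?(ltW q_gt0) //.
  by apply: le_trans kap2_ge1; rewrite exprn_ile1 ?(ltW q_gt0) //; have := q_le; lra.
rewrite -(ler_pM2r (exprn_gt0 2 a_gt0)).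
have -> : 100 * (kap ^+ 2 * q * K%:R) * a ^+ 2 = 100 * (q * (K%:R * (kap * a) ^+ 2)) by ring.
have : 0 <= q * (K%:R * (kap * a) ^+ 2).
  by rewrite (mulr_ge0 (ltW q_gt0)) // (le_trans (norm2sq_ge0 x) norm2sq_flat_le).
lra.
Qed.

End Error.

(** * Reduction of the theorem to the error analysis *)

Lemma kappa_ge (R : rcfType) n (x : 'cV[R]_n) i j : i \in supp x -> j \in supp x ->
  `|x i 0| / `|x j 0| <= kappa x.
Proof.
move=> iS jS; apply: le_trans (le_bigmax_cond _ _ iS).
exact: (le_bigmax_cond _ (fun j => `|x i 0| / `|x j 0|) jS).
Qed.

Theorem theorem3 :
  exists C : rat, 0 < C /\
  forall (R : rcfType) (m n K : nat) (Phi : 'M[R]_(m, n)) (d : R)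
         (x : 'cV[R]_n) (v : 'cV[R]_m) (T : {set 'I_n}) (r : 'cV[R]_m),
    (1 <= K)%N ->
    is_isometry_const Phi (2 * K) d ->
    0 < d ->
    #|supp x| = K ->
    snr_ge Phi x v (kappa x ^+ 2 / Num.sqrt d ^+ 3) ->
    omp_reach Phi (Phi *m x + v) K T r ->
    (#|T :\: supp x|%:R / #|supp x|%:R : R)
      <= ratr C * kappa x ^+ 2 * Num.sqrt d.
Proof.
exists 100; split=> // R m n K Phi d x v T r K0 [_ _ ripP _] d0 cS snr reach.
have -> : ratr 100 = 100 :> R by rewrite ratr_nat.
set q := Num.sqrt d in snr *; set kap := kappa x in snr *.
have q0 : 0 < q by rewrite sqrtr_gt0.
have dq : d = q ^+ 2 by rewrite sqr_sqrtr // ltW.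
have K0' : 0 < K%:R :> R by rewrite ltr0n.
have [cT _] := omp_reach_ls reach.
rewrite cS ler_pdivrMr //.
(* Both sets have [K] elements, so wrong selections are as many as missed indices. *)
have -> : #|T :\: supp x| = #|supp x :\: T| by rewrite !cardsD cT cS setIC.
(* If [kap ^+ 2 * q] exceeds 1/100, the claimed bound exceeds 1 and holds trivially. *)
case: (leP (kap ^+ 2 * q) 100^-1) => [kapq | kapq]; last first.
  apply: le_trans (_ : K%:R <= _).
    by rewrite ler_nat -cS subset_leq_card // subsetDl.
  rewrite ler_peMl ?(ltW K0') //; lra.
have [i0 i0S] : exists i, i \in supp x by apply/set0Pn; rewrite -card_gt0 cS.
have [j0 j0S jmin] : exists2 j, j \in supp x & forall i, i \in supp x -> `|x j 0| <= `|x i 0|.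
  by case: (@arg_minP _ _ _ i0 (mem (supp x)) (fun i => `|x i 0|) i0S) => j jS jm; exists j.
have a0 : 0 < `|x j0 0| by rewrite normr_gt0; rewrite inE in j0S.
have kap1 : 1 <= kap.
  by apply: le_trans (kappa_ge j0S j0S); rewrite divff // gt_eqF.
have x_le i : `|x i 0| <= kap * `|x j0 0|.
  case: (boolP (i \in supp x)) => iS; first by rewrite -ler_pdivrMr // kappa_ge.
  move: iS; rewrite inE negbK => /eqP->; rewrite normr0 mulr_ge0 //.
  exact: le_trans ler01 kap1.
have v_le : kap ^+ 2 * norm2sq v <= q ^+ 3 * norm2sq (Phi *m x).
  case: snr => [-> | snr].
    have -> : norm2sq (0 : 'cV[R]_m) = 0 by apply: big1 => i _; rewrite mxE expr0n.
    by rewrite mulr0 mulr_ge0 ?norm2sq_ge0 ?exprn_ge0 ?ltW.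
  have v0 : 0 < norm2sq v.
    (* If [norm2sq v] were 0, the quotient would be 0 by convention, contradicting its positive
       lower bound. *)
    rewrite lt_def norm2sq_ge0 andbT; apply/negP => /eqP v0; move: snr.
    rewrite v0 invr0 mulr0 leNgt divr_gt0 ?exprn_gt0 //; exact: lt_le_trans kap1.
  by move: snr; rewrite ler_pdivlMr // mulrAC ler_pdivrMr ?exprn_gt0 // [_ * q ^+ 3]mulrC.
pose N := \max_(j < K.+1 | j%:R <= 25 * q * K%:R) j.
have N_max j : (j <= K)%N -> j%:R <= 25 * q * K%:R -> (j <= N)%N.
  rewrite -ltnS => jK jle.
  exact: (leq_bigmax_cond (P := fun j : 'I_K.+1 => j%:R <= 25 * q * K%:R)
            (F := fun j => j : nat) (Ordinal jK)).
have N_le : N%:R <= 25 * q * K%:R.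
  rewrite /N; elim/big_ind: _ => [|i j|i] //.
    by rewrite !mulr_ge0 ?ltW.
  by rewrite /maxn; case: ifP.
have := omp_missed_le dq q0 kap1 kapq ripP K0 cS a0 jmin x_le v_le N_max N_le reach.
by rewrite !mulrA.
Qed.
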